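(* Let $X\subset U\subset\mathbb{R}^n$, where $U$ is open and $X$ is the closure in $U$ of its interior. Let $f:X\to\mathbb{R}$ and $p\in\mathbb{N}$, and suppose that $\nabla^pf:\tau^p(X)\to\mathbb{R}$. Then there is a $\mathcal{C}^p$ Whitney field $F=(F^\alpha)_{|\alpha|\le p}$ on $X$ such that $F^0=f$.
   Context: $\mathcal{P}_p$: real polynomials on $\mathbb{R}^n$ of degree $\le p$; $\mathcal{P}_p^*$ dual; $r=\dim\mathcal{P}_p$. For $\xi\in\mathcal{P}_p^*$, $b\in\mathbb{R}^n$, $|\alpha|\le p$: $\xi_\alpha(b):=\xi(\tfrac1{\alpha!}(x-b)^\alpha)$; $\delta_a(P)=P(a)$. A bundle over $X$ with fibres in $W$ is a subset of $X\times W$ with linear-subspace fibres. For a bundle $E\subset X\times\mathcal{P}_p^*$: $\Delta E=\{(a,b,\xi+\eta):a,b\in X,\xi\in E_a,\eta\in E_b,|a-b|^{p-|\alpha|}|\eta_\alpha(b)|\le1\ \forall|\alpha|\le p\}$, $E'=\{(a,\xi):(a,a,\xi)\in\overline{\Delta E}\}$, $\rho(E)=\{(a,\xi):\xi\in\operatorname{Span}E'_a\}$; $\tau^p(X):=\rho^{2r}(E_0)$ with $E_0=\{(a,\lambda\delta_a)\}$ (iterates constant from $2r$ on). For bundles $\Phi\subset X\times(\mathcal{P}_p^*\times\mathbb{R})$: $\Delta\Phi=\{(a,b,\xi+\eta,\lambda+\mu):(\xi,\lambda)\in\Phi_a,(\eta,\mu)\in\Phi_b,|a-b|^{p-|\alpha|}|\eta_\alpha(b)|\le1\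 \forall|\alpha|\le p\}$, $\Phi'=\{(a,\xi,\lambda):(a,a,\xi,\lambda)\in\overline{\Delta\Phi}\}$, $\rho(\Phi)$ fibrewise span of $\Phi'$; $\nabla^pf:=\rho^{2(r+1)}(\Phi_0)$ with $\Phi_0=\{(a,\lambda\delta_a,\lambda f(a))\}$. ''$\nabla^pf:\tau^p(X)\to\mathbb{R}$'' means each $\xi\in\tau^p_a(X)$ has exactly one $\lambda$ with $(a,\xi,\lambda)\in\nabla^pf$. A $\mathcal{C}^p$ Whitney field on $X$ is a family $F=(F^\alpha)_{|\alpha|\le p}$ of functions $X\to\mathbb{R}$ such that for every $c\in X$ and $|\alpha|\le p$, $\big(F^\alpha(b)-\sum_{|\beta|\le p-|\alpha|}\frac1{\beta!}F^{\alpha+\beta}(a)(b-a)^\beta\big)/|b-a|^{p-|\alpha|}\to0$ as $a,b\to c$ in $X$, $a\ne b$. *)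

(* Defs.v *)
From mathcomp Require Export all_boot all_algebra.
From mathcomp Require Export reals.
From mathcomp Require Export mpoly.
Import GRing.Theory Num.Theory.

Set Implicit Arguments.
Unset Strict Implicit.
Unset Printing Implicit Defensive.

Local Open Scope ring_scope.

Section Defs.
Variable R : realType.
Variables (n p : nat).

Definition pt := 'I_n -> R.

Definition dist (a b : pt) : R := Num.sqrt (\sum_(i < n) (a i - b i) ^+ 2).

(* multi-indices alpha with |alpha| <= p : they index the monomial basis
   x^alpha of P_p; r = dim P_p = #|Mon| *)
Definition Mon := 'X_{1..n < p.+1}.
Definition rdim : nat := #|{: Mon}|.

(* P_p^* : a linear functional xi on P_p is given by its values xi(x^alpha)
   on the monomial basis; xi(P) = sum_alpha P_alpha xi(x^alpha). *)
Definition dual := Mon -> R.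

Definition pair (xi : dual) (P : {mpoly R[n]}) : R :=
  \sum_(m : Mon) P@_m * xi m.

Definition mfact (a : 'X_{1..n}) : nat := \prod_(i < n) (a i)`!.

Definition mpow (v : pt) (a : 'X_{1..n}) : R := \prod_(i < n) v i ^+ a i.

Definition shifted_mono (b : pt) (a : 'X_{1..n}) : {mpoly R[n]} :=
  (mfact a)%:R^-1 *: \prod_(i < n) ('X_i - (b i)%:MP) ^+ a i.

Definition xi_at (xi : dual) (a : Mon) (b : pt) : R := pair xi (shifted_mono b a).

(* delta_a(P) = P(a) *)
Definition delta (a : pt) : dual := fun m => mpow a m.

Definition in_span (T : Type) (S : (T -> R) -> Prop) (v : T -> R) : Prop :=
  exists (k : nat) (c : 'I_k -> R) (w : 'I_k -> (T -> R)),
    (forall i, S (w i)) /\ forall t, v t = \sum_(i < k) c i * w i t.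

Section Bundles.
Variable X : pt -> Prop.

Definition bundle := pt -> dual -> Prop.

Definition DeltaE (E : bundle) (a b : pt) (z : dual) : Prop :=
  X a /\ X b /\ exists xi eta, E a xi /\ E b eta /\
    (forall m, z m = xi m + eta m) /\
    forall al : Mon, dist a b ^+ (p - mdeg al) * `|xi_at eta al b| <= 1.

Definition in_closure3 (S : pt -> pt -> dual -> Prop) (a b : pt) (z : dual) : Prop :=
  forall eps : R, 0 < eps -> exists a' b' z', S a' b' z' /\
    dist a a' < eps /\ dist b b' < eps /\ forall m, `|z m - z' m| < eps.

Definition Eprime (E : bundle) : bundle :=
  fun a xi => X a /\ in_closure3 (DeltaE E) a a xi.

Definition rho (E : bundle) : bundle :=
  fun a xi => X a /\ in_span (Eprime E a) xi.

Definition E0 : bundle := fun a xi => X a /\ exists l : R, forall m, xi m = l * delta a m.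

Definition tau : bundle := iter (2 * rdim) rho E0.

Definition bundleR := pt -> dual -> R -> Prop.

Definition DeltaPhi (Phi : bundleR) (a b : pt) (z : dual) (l : R) : Prop :=
  X a /\ X b /\ exists xi la eta mu, Phi a xi la /\ Phi b eta mu /\
    (forall m, z m = xi m + eta m) /\ l = la + mu /\
    forall al : Mon, dist a b ^+ (p - mdeg al) * `|xi_at eta al b| <= 1.

Definition in_closure3R (S : pt -> pt -> dual -> R -> Prop) (a b : pt) (z : dual) (l : R)
  : Prop :=
  forall eps : R, 0 < eps -> exists a' b' z' l', S a' b' z' l' /\
    dist a a' < eps /\ dist b b' < eps /\ (forall m, `|z m - z' m| < eps) /\
    `|l - l'| < eps.

Definition Phiprime (Phi : bundleR) : bundleR :=
  fun a xi l => X a /\ in_closure3R (DeltaPhi Phi) a a xi l.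

(* fibrewise span in P_p^* x R, encoded on option Mon (None = the R factor) *)
Definition pack (xi : dual) (l : R) : option Mon -> R :=
  fun o => if o is Some m then xi m else l.

Definition rhoR (Phi : bundleR) : bundleR :=
  fun a xi l => X a /\
    in_span (fun v : option Mon -> R => exists xi' l', Phiprime Phi a xi' l' /\
                 forall o, v o = pack xi' l' o) (pack xi l).

Definition Phi0 (f : pt -> R) : bundleR :=
  fun a xi l => X a /\ exists mu : R, (forall m, xi m = mu * delta a m) /\ l = mu * f a.

Definition nabla (f : pt -> R) : bundleR := iter (2 * rdim.+1) rhoR (Phi0 f).

End Bundles.

Definition interior (X : pt -> Prop) (x : pt) : Prop :=
  exists2 e : R, 0 < e & forall y, dist x y < e -> X y.

Definition is_open (U : pt -> Prop) : Prop := forall x, U x -> interior U x.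

Definition closure_in (U S : pt -> Prop) (x : pt) : Prop :=
  U x /\ forall e : R, 0 < e -> exists y, S y /\ dist x y < e.

(* C^p Whitney field on X: F alpha for |alpha| <= p (other components unused) *)
Definition whitney_field (X : pt -> Prop) (F : 'X_{1..n} -> pt -> R) : Prop :=
  forall (c : pt), X c -> forall al : 'X_{1..n}, (mdeg al <= p)%N ->
  forall eps : R, 0 < eps -> exists2 del : R, 0 < del &
    forall a b, X a -> X b -> a <> b -> dist a c < del -> dist b c < del ->
      `| (F al b - \sum_(be : Mon | (mdeg be <= p - mdeg al)%N)
              (mfact be)%:R^-1 * F (al + be)%MM a * mpow (fun i => b i - a i) be)
          / dist b a ^+ (p - mdeg al) | < eps.

End Defs.

(* Main.v *)
(* Over an interior point, difference quotients with step [h] satisfy the bound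
   defining [Delta], so [p] applications of [rho] produce all derivatives of order
   at most [p], and one more application fills the fibres over all of [X]; hence
   [tau] is the full dual.  If [nabla f] is single valued, every limit in the
   construction of [tau] lifts to [nabla f]: the values either cluster, or can be
   divided out to give the vertical vector [(0, 1)], which is excluded.  So
   [rho^(2r) Phi_0] is already the graph of a linear form [T_a] on each fibre, and
   it is still single valued after one more [rho].  Put
   [F^al a = T_a (P |-> (d^al P)(a))].  The Whitney remainder of order [al] is
   [T_b eta - T_a eta] with [eta = |a - b|^(|al| - p) d^al_b], which is admissible in
   [Delta]; if it did not tend to [0], rescaling would again give a nonzero
   vertical vector in a limit fibre. *)

Require Import Defs.
From mathcomp Require Import all_order boolp lra ring zify.
Import Order.TTheory GRing.Theory Num.Theory.

Set Implicit Arguments.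
Unset Strict Implicit.
Unset Printing Implicit Defensive.

Local Open Scope ring_scope.

(** * Binomial and multi-index expansions *)

(** Distributing gives a sum over all exponent functions with entries at most [p]. Those of total
    degree above [p] contribute nothing by hypothesis; the others are exactly the elements of
    [Mon n p]. This turns one-variable expansions into multivariate ones. *)
Lemma prod_sum_multinom (A : comNzRingType) (n p : nat) (g : 'I_n -> nat -> A) :
  (forall be : 'X_{1..n}, (p < mdeg be)%N -> \prod_(i < n) g i (be i) = 0) ->
  \prod_(i < n) \sum_(k < p.+1) g i k = \sum_(be : Mon n p) \prod_(i < n) g i (be i).
Proof.
move=> g0; rewrite bigA_distr_bigA.
pose mn (f : {ffun 'I_n -> 'I_p.+1}) : 'X_{1..n} := [multinom (f i : nat) | i < n].
have z0 : Mon n p by apply: (@BMultinom _ _ 0%MM); rewrite mdeg0.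
have lemon (be : Mon n p) i : (be i < p.+1)%N.
  apply: leq_ltn_trans (valP be); rewrite /= mdegE (bigD1 i) //=; exact: leq_addr.
rewrite (bigID (fun f => mdeg (mn f) < p.+1)%N) /= [X in _ + X]big1 ?addr0; last first.
  move=> f; rewrite -leqNgt => /g0 <-; apply: eq_bigr => i _.
  by rewrite mnmE.
have mn_inord (be : Mon n p) : mn [ffun i => inord (be i)] = be.
  by apply/mnmP => i; rewrite mnmE ffunE inordK.
rewrite (reindex_onto (fun be : Mon n p => [ffun i => inord (be i)])
           (fun f => insubd z0 (mn f))) /=; last first.
  move=> f lef; apply/ffunP => i; rewrite ffunE; apply: val_inj => /=.
  suff -> : bmnm (insubd z0 (mn f)) = mn f by rewrite mnmE inordK.
  by rewrite -[LHS]/(val _) val_insubd lef.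
apply: eq_big => [be | be _].
  have -> : insubd z0 (mn [ffun i => inord (be i)]) = be.
    by apply: val_inj; rewrite val_insubd mn_inord (valP be).
  by rewrite mn_inord (valP be) eqxx.
by apply: eq_bigr => i _; rewrite ffunE inordK.
Qed.

Lemma ffactnD (n m k : nat) : n ^_ (m + k) = (n ^_ m * (n - m) ^_ k)%N.
Proof.
elim: k => [|k IHk]; first by rewrite addn0 ffactn0 muln1.
by rewrite addnS !ffactnSr IHk -mulnA subnDA.
Qed.

Lemma binomial_expansion (A : comNzRingType) (x y : A) (k m : nat) :
  (m <= k)%N ->
  (x + y) ^+ m = \sum_(j < k.+1) ('C(m, j))%:R * x ^+ (m - j) * y ^+ j.
Proof.
move=> lemk; rewrite exprDn.
rewrite (big_ord_widen k.+1 (fun j => x ^+ (m - j) * y ^+ j *+ 'C(m, j))) //.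
rewrite [RHS](bigID (fun j : 'I__ => j < m.+1)%N) /= [X in _ = _ + X]big1 ?addr0.
  by apply: eq_bigr => j _; rewrite -mulr_natl mulrA.
by move=> j; rewrite -leqNgt => ltj; rewrite bin_small ?mul0r.
Qed.

(** * Derivative functionals and Taylor expansion *)

Section Functionals.
Variables (R : realType) (n p : nat).
Implicit Types (a b : pt R n) (al be : 'X_{1..n}) (m : Mon n p).

(* The functional [P |-> (d^al P)(b)]. *)
Definition dderiv al b : dual R n p :=
  fun m => \prod_(i < n) ((bmnm m i ^_ al i)%:R * b i ^+ (bmnm m i - al i)).

Lemma dderiv0 b : dderiv 0%MM b = delta b.
Proof.
apply/funext => m; apply: eq_bigr => i _.
by rewrite mnm0E ffactn0 mul1r subn0.
Qed.

Lemma dderiv_eq0 al b m : (p < mdeg al)%N -> dderiv al b m = 0.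
Proof.
move=> lt_al; have [i lti] : exists i, (bmnm m i < al i)%N.
  apply/existsP; apply: contraLR lt_al; rewrite negb_exists => /forallP le_al.
  rewrite -leqNgt; apply: leq_trans (valP m : mdeg m <= p)%N.
  by rewrite !mdegE; apply: leq_sum => i _; rewrite leqNgt.
by rewrite /dderiv (bigD1 i) //= ffact_small // !mul0r.
Qed.

Lemma mon_le m i : (bmnm m i <= p)%N.
Proof.
apply: leq_trans (valP m : mdeg m <= p)%N.
by rewrite mdegE (bigD1 i) //= leq_addr.
Qed.

Lemma fact_neq0 k : (k`!)%:R != 0 :> R.
Proof. by rewrite pnatr_eq0 -lt0n fact_gt0. Qed.

Lemma bin_div k l : ('C(l, k))%:R = (k`!)%:R^-1 * (l ^_ k)%:R :> R.
Proof.
by apply: (mulfI (fact_neq0 k)); rewrite mulVKf ?fact_neq0 // -natrM mulnC bin_ffact.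
Qed.

Lemma mfact_inv al : (mfact al)%:R^-1 = \prod_(i < n) ((al i)`!)%:R^-1 :> R.
Proof. by rewrite /mfact natr_prod prodfV. Qed.

(** Expand each [b i = a i + (b i - a i)] by the binomial formula and multiply over the coordinates.
    The formula is exact because derivatives of order above [p] kill the monomial [m]. *)
Lemma dderiv_taylor al a b m :
  dderiv al b m = \sum_(be : Mon n p)
    (mfact be)%:R^-1 * mpow (fun i => b i - a i) be * dderiv (al + be)%MM a m.
Proof.
pose g i k : R := (k`!)%:R^-1 * (b i - a i) ^+ k *
  ((bmnm m i ^_ (al i + k))%:R * a i ^+ (bmnm m i - (al i + k))).
have gE be : \prod_(i < n) g i (be i) =
    (mfact be)%:R^-1 * mpow (fun i => b i - a i) be * dderiv (al + be)%MM a m.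
  rewrite mfact_inv -!big_split /=; apply: eq_bigr => i _; rewrite /g mnmDE //.
transitivity (\prod_(i < n) \sum_(k < p.+1) g i k); last first.
  rewrite prod_sum_multinom; first by apply: eq_bigr => be _; rewrite gE.
  move=> be ltbe; rewrite gE dderiv_eq0 ?mulr0 // mdegD.
  exact: leq_trans ltbe (leq_addl _ _).
apply: eq_bigr => i _; rewrite -{1}[b i](subrKC (a i)).
rewrite (@binomial_expansion _ _ _ p); last exact: leq_trans (leq_subr _ _) (mon_le m i).
rewrite mulr_sumr; apply: eq_bigr => k _.
rewrite /g ffactnD bin_div natrM subnDA; ring.
Qed.

Lemma mono_taylor b m :
  'X_[m] = \sum_(al : Mon n p) dderiv al b m *: shifted_mono b al.
Proof.
pose g i k : {mpoly R[n]} := ((k`!)%:R^-1 * ((bmnm m i ^_ k)%:R * b i ^+ (bmnm m i - k)))%:MP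
  * ('X_i - (b i)%:MP) ^+ k.
have gE al : \prod_(i < n) g i (al i) = dderiv al b m *: shifted_mono b al.
  rewrite /shifted_mono scalerA mfact_inv -big_split /= -mul_mpolyC.
  rewrite rmorph_prod -big_split /=; apply: eq_bigr => i _.
  by rewrite /g [X in X%:MP * _]mulrC.
rewrite mpolyXE_id -[RHS](eq_bigr _ (fun (al : Mon n p) _ => gE al)).
rewrite -prod_sum_multinom; last by move=> al ltal; rewrite gE dderiv_eq0 ?scale0r.
apply: eq_bigr => i _; rewrite -{1}['X_i](subrKC ((b i)%:MP)).
rewrite (@binomial_expansion _ _ _ p (bmnm m i)) ?mon_le //; apply: eq_bigr => k _.
by rewrite /g mulrA -bin_div rmorphM rmorphXn /= rmorph_nat.
Qed.

Lemma pair_sum (xi : dual R n p) I (r : seq I) (P : I -> {mpoly R[n]}) (c : I -> R) :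
  pair xi (\sum_(i <- r) c i *: P i) = \sum_(i <- r) c i * pair xi (P i).
Proof.
rewrite /pair; under [RHS]eq_bigr do rewrite mulr_sumr.
rewrite exchange_big; apply: eq_bigr => m _ /=.
rewrite raddf_sum mulr_suml; apply: eq_bigr => i _.
by rewrite /= mcoeffZ mulrA.
Qed.

Lemma pair_mono (xi : dual R n p) m : pair xi 'X_[m] = xi m.
Proof.
rewrite /pair (bigD1 m) //= mcoeffX eqxx mul1r big1 ?addr0 // => m' nem.
rewrite mcoeffX; case: eqP => [/val_inj e|]; last by rewrite mul0r.
by rewrite e eqxx in nem.
Qed.

(** Pairing [xi] with the Taylor expansion of a monomial at [b] shows that the functionals
    [dderiv al b] span the dual, with coordinates [xi_at xi al b]. *)
Lemma dual_expansion (xi : dual R n p) b :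
  xi = fun m => \sum_(al : Mon n p) xi_at xi al b * dderiv al b m.
Proof.
apply/funext => m; rewrite -[LHS]pair_mono (mono_taylor b) pair_sum.
by apply: eq_bigr => al _; rewrite mulrC.
Qed.

(* The matrices of the two families in the monomial basis are inverse to each
   other; [mono_taylor] gives one of the two products. *)
Lemma xi_at_dderiv (al be : Mon n p) b :
  xi_at (dderiv al b) be b = (al == be)%:R.
Proof.
pose D := \matrix_(i < #|{: Mon n p}|, j < #|{: Mon n p}|)
  dderiv (bmnm (enum_val j)) b (enum_val i).
pose S := \matrix_(i < #|{: Mon n p}|, j < #|{: Mon n p}|)
  (shifted_mono b (bmnm (enum_val i)))@_(bmnm (enum_val j)).
have sumE (F : Mon n p -> R) : \sum_(i < #|{: Mon n p}|) F (enum_val i) = \sum_m F m.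
  by rewrite [RHS](reindex _ (onW_bij _ (enum_val_bij _))).
have DS : D *m S = 1%:M.
  apply/matrixP => i j; rewrite !mxE.
  transitivity (('X_[bmnm (enum_val i)] : {mpoly R[n]})@_(bmnm (enum_val j))).
    rewrite (mono_taylor b) raddf_sum -sumE; apply: eq_bigr => k _.
    by rewrite !mxE [RHS]mcoeffZ.
  by rewrite mcoeffX -[_ == _]/(enum_val i == enum_val j) (inj_eq enum_val_inj).
move/mulmx1C: DS => /matrixP /(_ (enum_rank be) (enum_rank al)).
rewrite !mxE (inj_eq enum_rank_inj) eq_sym => <-.
rewrite /xi_at /pair -sumE; apply: eq_bigr => k _.
by rewrite !mxE !enum_rankK.
Qed.

Lemma xi_at0 (al : Mon n p) b : xi_at (fun=> 0 : R) al b = 0.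
Proof. by rewrite /xi_at /pair big1 // => m _; rewrite mulr0. Qed.

Lemma xi_atZ (c : R) (xi : dual R n p) (al : Mon n p) b :
  xi_at (fun m => c * xi m) al b = c * xi_at xi al b.
Proof. by rewrite /xi_at /pair mulr_sumr; apply: eq_bigr => m _; ring. Qed.

End Functionals.

(** * Spans and fibrewise linear bundles *)

Section Span.
Variables (R : realType) (T : Type).
Implicit Types (S : (T -> R) -> Prop) (v w : T -> R).

Lemma in_span0 S : in_span S (fun=> 0).
Proof.
by exists 0, (fun=> 0), (fun=> fun=> 0); split=> [[]//|t]; rewrite big_ord0.
Qed.

Lemma in_span_gen S v : S v -> in_span S v.
Proof.
by move=> Sv; exists 1, (fun=> 1), (fun=> v); split=> // t; rewrite big_ord1 mul1r.
Qed.

Lemma in_span_lin S (c : R) v w :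
  in_span S v -> in_span S w -> in_span S (fun t => c * v t + w t).
Proof.
move=> [k1 [c1 [w1 [S1 E1]]]] [k2 [c2 [w2 [S2 E2]]]].
exists (k1 + k2)%N.
exists (fun i => match split i with inl j => c * c1 j | inr j => c2 j end).
exists (fun i => match split i with inl j => w1 j | inr j => w2 j end).
split=> [i|t]; first by case: (split i) => j.
rewrite big_split_ord E1 E2 mulr_sumr; congr (_ + _); apply: eq_bigr => i _.
  by rewrite (unsplitK (inl i)) mulrA.
by rewrite (unsplitK (inr i)).
Qed.

Lemma in_span_ind S (Q : (T -> R) -> Prop) :
  Q (fun=> 0) -> (forall c v w, Q v -> Q w -> Q (fun t => c * v t + w t)) ->
  (forall v, S v -> Q v) -> forall v, in_span S v -> Q v.
Proof.
move=> Q0 QL SQ v [k [c [w [Sw Ev]]]].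
have -> : v = fun t => \sum_(i <- enum 'I_k) c i * w i t.
  by apply/funext => t; rewrite Ev big_enum.
elim: (enum 'I_k) => [|i s IHs].
  by under eq_fun do rewrite big_nil.
under eq_fun do rewrite big_cons.
by apply: QL => //; apply: SQ.
Qed.

End Span.

Section LinearBundles.
Variables (R : realType) (n p : nat) (X : pt R n -> Prop).
Implicit Types (E : bundle R n p) (Phi : bundleR R n p) (a b : pt R n).

Lemma dist_refl a : dist a a = 0.
Proof.
by rewrite /dist big1 ?sqrtr0 // => i _; rewrite subrr expr0n.
Qed.

Lemma dist_sym a b : dist a b = dist b a.
Proof. by congr Num.sqrt; apply: eq_bigr => i _; rewrite -sqrrN opprB. Qed.

Lemma dist_ge0 a b : 0 <= dist a b.
Proof. exact: sqrtr_ge0. Qed.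

Record linear_bundle E : Prop := LinearBundle {
  lb_base : forall a xi, E a xi -> X a;
  lb_zero : forall a, X a -> E a (fun=> 0);
  lb_comb : forall a c xi eta,
    E a xi -> E a eta -> E a (fun m => c * xi m + eta m) }.

Record linear_bundleR Phi : Prop := LinearBundleR {
  lbR_base : forall a xi l, Phi a xi l -> X a;
  lbR_zero : forall a, X a -> Phi a (fun=> 0) 0;
  lbR_comb : forall a c xi l eta mu, Phi a xi l -> Phi a eta mu ->
    Phi a (fun m => c * xi m + eta m) (c * l + mu) }.

Lemma lb_scale E a c xi : linear_bundle E -> E a xi -> E a (fun m => c * xi m).
Proof.
move=> linE Exi; have /(lb_zero linE) E0 := lb_base linE Exi.
by under eq_fun do rewrite -[_ * _]addr0; apply: lb_comb.
Qed.

Lemma lb_sum E a I (s : seq I) (c : I -> R) (w : I -> dual R n p) :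
  linear_bundle E -> X a -> (forall i, E a (w i)) ->
  E a (fun m => \sum_(i <- s) c i * w i m).
Proof.
move=> linE Xa Ew; elim: s => [|i s IHs].
  by under eq_fun do rewrite big_nil; apply: lb_zero.
by under eq_fun do rewrite big_cons; apply: lb_comb.
Qed.

Lemma lbR_scale Phi a c xi l :
  linear_bundleR Phi -> Phi a xi l -> Phi a (fun m => c * xi m) (c * l).
Proof.
move=> linP Pxi; have /(lbR_zero linP) P0 := lbR_base linP Pxi.
rewrite -[c * l]addr0; under eq_fun do rewrite -[_ * _]addr0.
exact: lbR_comb.
Qed.

Lemma E0_linear : linear_bundle (E0 X).
Proof.
split=> [a xi [] //|a Xa|a c xi eta [Xa [k Ek]] [_ [l El]]].
  by split=> //; exists 0 => m; rewrite mul0r.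
by split=> //; exists (c * k + l) => m; rewrite Ek El; ring.
Qed.

Lemma rho_linear E : linear_bundle (rho X E).
Proof.
split=> [a xi [] //|a Xa|a c xi eta [Xa s1] [_ s2]].
  by split=> //; apply: in_span0.
by split=> //; apply: in_span_lin.
Qed.

Lemma iter_rho_linear k : linear_bundle (iter k (rho X) (@E0 R n p X)).
Proof. by case: k => [|k]; [apply: E0_linear|apply: rho_linear]. Qed.

(** Taking both points of [DeltaE] equal to [b] and [eta = 0] makes the bounds trivial, so one [rho]
    absorbs limits of a fixed functional along nearby fibres. *)
Lemma closure_rho E a xi : linear_bundle E -> X a ->
  (forall eps, 0 < eps -> exists2 b, E b xi & dist a b < eps) -> rho X E a xi.
Proof.
move=> linE Xa clE; split=> //; apply: in_span_gen; split=> // eps eps0.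
have [b Eb ltb] := clE _ eps0; have Xb := lb_base linE Eb.
exists b, b, xi; split; last by do !split=> //; move=> m; rewrite subrr normr0.
split=> //; split=> //; exists xi, (fun=> 0).
split=> //; split; first exact: lb_zero.
by split=> [m|al]; rewrite ?addr0 // xi_at0 normr0 mulr0.
Qed.

Lemma sub_rho E a xi : linear_bundle E -> E a xi -> rho X E a xi.
Proof.
move=> linE Ea; apply: closure_rho => //; first exact: lb_base Ea.
by move=> eps eps0; exists a; rewrite ?dist_refl.
Qed.

Variable f : pt R n -> R.

Lemma Phi0_linear : linear_bundleR (Phi0 X f).
Proof.
split=> [a xi l [] //|a Xa|a c xi l eta mu [Xa [k [Ek ->]]] [_ [k' [Ek' ->]]]].
  by split=> //; exists 0; split=> [m|]; rewrite mul0r.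
by split=> //; exists (c * k + k'); split=> [m|]; rewrite ?Ek ?Ek'; ring.
Qed.

Lemma rhoR_linear Phi : linear_bundleR (rhoR X Phi).
Proof.
split=> [a xi l [] //|a Xa|a c xi l eta mu [Xa s1] [_ s2]].
  split=> //; have -> : pack (fun=> 0 : R) 0 = (fun=> 0) :> (option (Mon n p) -> R).
    by apply/funext => -[].
  exact: in_span0.
split=> //; suff -> : pack (fun m => c * xi m + eta m) (c * l + mu) =
    fun o => c * pack xi l o + pack eta mu o by apply: in_span_lin.
by apply/funext => -[].
Qed.

Lemma iter_rhoR_linear k : linear_bundleR (iter k (rhoR X) (@Phi0 R n p X f)).
Proof. by case: k => [|k]; [apply: Phi0_linear|apply: rhoR_linear]. Qed.

Lemma Phiprime_rhoR Phi a xi l : Phiprime X Phi a xi l -> rhoR X Phi a xi l.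
Proof.
move=> P'; split; first by case: P'.
by apply: in_span_gen; exists xi, l.
Qed.

Lemma sub_rhoR Phi a xi l : linear_bundleR Phi -> Phi a xi l -> rhoR X Phi a xi l.
Proof.
move=> linP Pa; have Xa := lbR_base linP Pa.
apply: Phiprime_rhoR; split=> // eps eps0.
exists a, a, xi, l; rewrite dist_refl subrr normr0; split; last first.
  by do !split=> //; move=> m; rewrite subrr normr0.
split=> //; split=> //; exists xi, l, (fun=> 0), 0; rewrite addr0.
split=> //; split; first exact: lbR_zero.
by do !split=> //; [move=> m; rewrite addr0|move=> al; rewrite xi_at0 normr0 mulr0].
Qed.

Lemma iter_rhoR_le j k a xi l : (j <= k)%N ->
  iter j (rhoR X) (@Phi0 R n p X f) a xi l -> iter k (rhoR X) (@Phi0 R n p X f) a xi l.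
Proof.
move=> /subnK <- Pj; elim: (k - j)%N => // i IHi.
by apply: sub_rhoR => //; apply: iter_rhoR_linear.
Qed.

(** The bounds on [eta] survive contraction, which is what allows division by large values later. *)
Lemma DeltaPhi_scale Phi a b z l c : linear_bundleR Phi -> `|c| <= 1 ->
  DeltaPhi X Phi a b z l -> DeltaPhi X Phi a b (fun m => c * z m) (c * l).
Proof.
move=> linP c1 [Xa [Xb [xi [la [eta [mu [Pa [Pb [Ez [-> le1]]]]]]]]]].
split=> //; split=> //.
exists (fun m => c * xi m), (c * la), (fun m => c * eta m), (c * mu).
split; first exact: lbR_scale. split; first exact: lbR_scale.
split=> [m|]; first by rewrite Ez mulrDr.
split=> [|al]; first by rewrite mulrDr.
rewrite xi_atZ normrM mulrCA; apply: le_trans (le1 al).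
by rewrite ler_piMl // mulr_ge0 // exprn_ge0 // dist_ge0.
Qed.

End LinearBundles.

(** * Lifting limits from [Delta E] to [Delta Phi] *)

Lemma bounded_cluster (R : realType) (P : R -> R -> Prop) (M : R) :
  (forall e e' l, e <= e' -> P e l -> P e' l) ->
  (forall e, 0 < e -> exists2 l, P e l & `|l| <= M) ->
  exists l, forall e, 0 < e -> exists2 l', P e l' & `|l - l'| < e.
Proof.
move=> Pmono Pbnd.
(* The cluster value is [sup S], the lower limit as [e] tends to 0 of the values bounded by [M]. *)
pose S (t : R) := exists2 e, 0 < e & forall l, P e l -> `|l| <= M -> t < l.
have supS : classical_sets.has_sup S.
  split.
    exists (- M - 1); exists 1 => // l _; rewrite ler_norml => /andP[+ _]; lra.
  exists M => t [e e0 He]; have [l Pl lM] := Pbnd _ e0.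
  have := He _ Pl lM; move: lM; rewrite ler_norml => /andP[_ lM]; lra.
exists (sup S) => e e0.
have e20 : 0 < e / 2 by lra.
have [s [e1 e10 He1] lts] := sup_adherent e20 supS.
have nS : ~ S (sup S + e / 2).
  by move=> /(sup_upper_bound supS); lra.
have [l [Pl lM lel]] : exists l, [/\ P (Num.min e e1) l, `|l| <= M & l <= sup S + e / 2].
  apply: contrapT => H; apply: nS; exists (Num.min e e1); first by rewrite lt_min e0.
  move=> l Pl lM; rewrite ltNge; apply/negP => lel; apply: H; by exists l.
exists l; first by apply: Pmono Pl; rewrite ge_min lexx.
have : s < l by apply: He1 => //; apply: Pmono Pl; rewrite ge_min lexx orbT.
by move=> ltsl; rewrite ltr_norml; apply/andP; split; lra.
Qed.

Section Lift.
Variables (R : realType) (n p : nat) (X : pt R n -> Prop).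
Implicit Types (Phi : bundleR R n p) (a b : pt R n).

(* Either the last coordinates stay bounded and cluster, or dividing by them
   produces the vertical direction. *)
Lemma Phiprime_lift Phi a (z : dual R n p) : linear_bundleR X Phi -> X a ->
  (forall eps, 0 < eps -> exists a' b' z' l', DeltaPhi X Phi a' b' z' l' /\
     dist a a' < eps /\ dist a b' < eps /\ forall m, `|z m - z' m| < eps) ->
  (exists l, Phiprime X Phi a z l) \/ Phiprime X Phi a (fun=> 0) 1.
Proof.
move=> linP Xa clz.
pose P eps l := exists a' b' z', DeltaPhi X Phi a' b' z' l /\
     dist a a' < eps /\ dist a b' < eps /\ forall m, `|z m - z' m| < eps.
have Pmono e e' l : e <= e' -> P e l -> P e' l.
  move=> lee [a' [b' [z' [D [d1 [d2 d3]]]]]]; exists a', b', z'.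
  split=> //; split; first exact: lt_le_trans lee.
  by split=> [|m]; apply: lt_le_trans lee.
have [[M HM]|H] := pselect (exists M, forall e, 0 < e -> exists2 l, P e l & `|l| <= M).
  left; have [l Hl] := bounded_cluster Pmono HM; exists l; split=> // eps eps0.
  have [l' [a' [b' [z' [D [d1 [d2 d3]]]]]] ltl] := Hl _ eps0.
  by exists a', b', z', l'.
right; split=> // eps eps0.
pose K := \sum_m `|z m| + 1.
have zK m : `|z m| + 1 <= K.
  by rewrite /K (bigD1 m) //= lerD2r lerDl sumr_ge0.
have K0 : 0 < K.
  by rewrite /K ltr_wpDl ?sumr_ge0.
(* A value beyond 1 makes its inverse an admissible contraction factor; beyond [K / eps], it also
   shrinks every coordinate of [z'] below [eps], since these are at most [K] once [z'] is within 1
   of [z]. *)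
pose M := Num.max 1 (K / eps).
have [e e0 He] : exists2 e, 0 < e & forall l, P e l -> M < `|l|.
  apply: contrapT => H'; apply: H; exists M => e e0.
  apply: contrapT => H; apply: H'; exists e => // l Pl.
  by rewrite ltNge; apply/negP => lel; apply: H; exists l.
pose e' := Num.min e (Num.min eps 1).
have e'0 : 0 < e' by rewrite !lt_min e0 eps0 /=.
have [a' [b' [z' [l' [D [d1 [d2 d3]]]]]]] := clz _ e'0.
have Ml : M < `|l'|.
  apply: He; apply: (@Pmono e'); first by rewrite /e' ge_min lexx.
  by exists a', b', z'.
have [e'eps e'1] : e' <= eps /\ e' <= 1.
  by split; rewrite /e' !ge_min lexx ?orbT.
have l1 : 1 < `|l'| by apply: le_lt_trans Ml; rewrite le_max lexx.
have l0 : l' != 0 by rewrite -normr_gt0; lra.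
exists a', b', (fun m => l'^-1 * z' m), (l'^-1 * l'); split.
  by apply: DeltaPhi_scale => //; rewrite normfV invf_le1 ?ltW //; lra.
split; first exact: lt_le_trans e'eps. split; first exact: lt_le_trans e'eps.
split=> [m|]; last by rewrite mulVf // subrr normr0.
rewrite sub0r normrN normrM normfV mulrC ltr_pdivrMr; last by lra.
have Keps : K < eps * `|l'|.
  rewrite mulrC -ltr_pdivrMr //; apply: le_lt_trans Ml.
  by rewrite le_max lexx orbT.
apply: le_lt_trans Keps; apply: le_trans (zK m).
have -> : z' m = z m - (z m - z' m) by ring.
by apply: le_trans (ler_normB _ _) _; have := d3 m; lra.
Qed.

Variable f : pt R n -> R.

(** Induction on [k]. The values [la] and [mu] attached to the two summands are not controlled,
    hence the dichotomy of [Phiprime_lift]. Its vertical alternative would persist up to stage [N],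
    where it contradicts the hypothesis. *)
Lemma iter_rho_lift N :
  (forall a l, iter N (rhoR X) (@Phi0 R n p X f) a (fun=> 0) l -> l = 0) ->
  forall k a xi, (k <= N)%N -> iter k (rho X) (@E0 R n p X) a xi ->
  exists l, iter k (rhoR X) (Phi0 X f) a xi l.
Proof.
move=> single; elim=> [|k IHk] a zeta leN.
  by move=> [Xa [l El]]; exists (l * f a); split=> //; exists l.
have linS := @iter_rhoR_linear R n p X f k.+1.
move=> [Xa]; apply: (in_span_ind
  (Q := fun xi => exists l, iter k.+1 (rhoR X) (@Phi0 R n p X f) a xi l))
  => [|c v w [l1 P1] [l2 P2]|z [_ cz]].
- by exists 0; apply: lbR_zero linS _ Xa.
- by exists (c * l1 + l2); exact: (lbR_comb linS c P1 P2).
have linP := @iter_rhoR_linear R n p X f k.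
have [|[l Pl]|P1] := Phiprime_lift (z := z) linP Xa _.
- move=> eps eps0.
  have [a' [b' [z' [[Xa' [Xb' [xi [eta [Exi [Eeta [Ez' le1]]]]]]] dd]]]] := cz _ eps0.
  have [la Pla] := IHk _ _ (ltnW leN) Exi.
  have [mu Pmu] := IHk _ _ (ltnW leN) Eeta.
  exists a', b', z', (la + mu); split=> //; split=> //; split=> //.
  by exists xi, la, eta, mu.
- by exists l; apply: Phiprime_rhoR.
have /single/eqP : iter N (rhoR X) (@Phi0 R n p X f) a (fun=> 0) 1.
  by apply: (@iter_rhoR_le R n p X f _ _ _ _ _ leN); apply: Phiprime_rhoR.
by rewrite oner_eq0.
Qed.

End Lift.

(** * The fibres of [tau] *)

Section Tau.
Variables (R : realType) (n p : nat) (X : pt R n -> Prop).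
Implicit Types (a b x : pt R n).

Definition shift x (i : 'I_n) (h : R) : pt R n := fun j => x j + h *+ (j == i).

Lemma dist_shift x i h : 0 <= h -> dist x (shift x i h) = h.
Proof.
move=> h0; rewrite /dist (bigD1 i) //= big1 => [|j /negbTE ji].
  rewrite addr0 /shift eqxx mulr1n opprD addrA subrr add0r sqrrN.
  by rewrite sqrtr_sqr ger0_norm.
by rewrite /shift ji mulr0n addr0 subrr expr0n.
Qed.

(** The displacement lies along axis [i]: the power vanishes if [be] involves another axis, and
    otherwise [be] is a multiple of [U_(i)] by at least 2. *)
Lemma mpow_shift x i h (be : 'X_{1..n}) : 0 <= h -> h <= 1 ->
  be != 0%MM -> be != U_(i)%MM ->
  `|mpow (fun j => shift x i h j - x j) be| <= h ^+ 2.
Proof.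
move=> h0 h1 be0 beU.
have vE j : shift x i h j - x j = h *+ (j == i) by rewrite /shift addrC addKr.
have [/existsP[j /andP[ji bej]]|] := boolP [exists j, (j != i) && (be j != 0%N)].
  suff -> : mpow (fun j => shift x i h j - x j) be = 0.
    by rewrite normr0 exprn_ge0.
  apply/eqP/prodf_eq0; exists j => //.
  by rewrite vE (negbTE ji) mulr0n expr0n (negbTE bej).
rewrite negb_exists => /forallP be0j.
have {}be0j j : j != i -> be j = 0%N.
  by move=> ji; move: (be0j j); rewrite ji negbK => /eqP.
rewrite /mpow (bigD1 i) //= big1 => [|j /be0j ->]; last by rewrite expr0.
rewrite mulr1 vE eqxx mulr1n ger0_norm ?exprn_ge0 //.
apply: ler_wiXn2l => //.
case bei: (be i) => [|[|k]] //.
  case/eqP: be0; apply/mnmP => j; rewrite mnm0E.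
  by have [->|/be0j] := eqVneq j i.
case/eqP: beU; apply/mnmP => j; rewrite mnm1E.
by have [<-|/negbTE ij] := eqVneq i j; [rewrite bei|apply: be0j; rewrite eq_sym ij].
Qed.

Lemma mfact_gt0 (be : 'X_{1..n}) : (0 < mfact be)%N.
Proof. by rewrite prodn_gt0 // => i; apply: fact_gt0. Qed.

(** In the Taylor expansion the terms of index 0 and [U_(i)] give the value and the derivative; all
    others are of order [h ^+ 2]. Summing over all [m] makes [C] uniform. *)
Lemma dderiv_quotient (al : 'X_{1..n}) x i : (0 < p)%N ->
  exists2 C : R, 0 <= C & forall h, 0 < h -> h <= 1 -> forall m : Mon n p,
    `|dderiv (al + U_(i))%MM x m
       - h^-1 * (dderiv al (shift x i h) m - dderiv al x m)| <= C * h.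
Proof.
move=> p0.
pose C := \sum_(m : Mon n p) \sum_(be : Mon n p) `|dderiv (al + be)%MM x m|.
exists C => [|h h0 h1 m]; first by rewrite sumr_ge0 // => m _; rewrite sumr_ge0.
have z_lt : (mdeg (0%MM : 'X_{1..n}) < p.+1)%N by rewrite mdeg0.
have u_lt : (mdeg (U_(i)%MM : 'X_{1..n}) < p.+1)%N by rewrite mdeg1.
pose z : Mon n p := BMultinom z_lt; pose u : Mon n p := BMultinom u_lt.
have uz : u != z.
  by apply/eqP => /(congr1 (mdeg \o val)); rewrite /= mdeg0 mdeg1.
rewrite (dderiv_taylor al x (shift x i h)) (bigD1 z) //= (bigD1 u) //=.
have -> : mfact (0%MM : 'X_{1..n}) = 1%N.
  by rewrite /mfact big1 // => j _; rewrite mnm0E.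
have -> : mfact (U_(i)%MM : 'X_{1..n}) = 1%N.
  by rewrite /mfact big1 // => j _; rewrite mnm1E; case: eqP.
have -> : mpow (fun j => shift x i h j - x j) 0%MM = 1.
  by rewrite /mpow big1 // => j _; rewrite mnm0E.
have -> : mpow (fun j => shift x i h j - x j) U_(i)%MM = h.
  rewrite /mpow (bigD1 i) //= big1 => [|j /negbTE ji].
    by rewrite mnm1E eqxx /shift eqxx mulr1n addrC addKr mulr1.
  by rewrite mnm1E eq_sym ji.
rewrite addm0 invr1 !mul1r; set S := \sum_(_ | _) _.
have -> : dderiv (al + U_(i))%MM x m
    - h^-1 * (dderiv al x m + (h * dderiv (al + U_(i))%MM x m + S) - dderiv al x m)
    = - (h^-1 * S) by field; lra.
rewrite normrN normrM normfV (gtr0_norm h0) mulrC ler_pdivrMr //.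
apply: le_trans (ler_norm_sum _ _ _) _; rewrite -mulrA -expr2.
apply: (@le_trans _ _ ((\sum_(be : Mon n p) `|dderiv (al + be)%MM x m|) * h ^+ 2)); last first.
  apply: ler_wpM2r; first exact: exprn_ge0 (ltW h0).
  by rewrite /C [leRHS](bigD1 m) //= lerDl sumr_ge0 // => m' _; rewrite sumr_ge0.
rewrite mulr_suml [leRHS](bigID (fun be => (be != z) && (be != u))) /=.
apply: (@le_trans _ _ (\sum_(be : Mon n p | (be != z) && (be != u))
  `|dderiv (al + be)%MM x m| * h ^+ 2)); last first.
  by rewrite lerDl sumr_ge0 // => be _; rewrite mulr_ge0 // exprn_ge0 // ltW.
apply: ler_sum => be /andP[bez beu].
rewrite normrM mulrC ler_wpM2l // normrM normfV normr_nat -[leRHS]mul1r.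
rewrite ler_pM ?invr_ge0 ?mpow_shift ?(ltW h0) //.
by rewrite invf_le1 ?ler1n ?ltr0n mfact_gt0.
Qed.

(** Interior for the sup norm, convenient for moves along one coordinate. *)
Definition cube_interior x := exists2 e : R, 0 < e &
  forall y : pt R n, (forall i, `|x i - y i| < e) -> X y.

Lemma interior_cube x : interior X x -> cube_interior x.
Proof.
move=> [e e0 He].
(* The factor [n.+1] suffices because [n * d ^+ 2 < (d * n.+1) ^+ 2], and it stays nonzero when
   [n = 0]. *)
have [d d0 ed] : exists2 d, 0 < d & e = d * n.+1%:R.
  by exists (e / n.+1%:R); rewrite ?divr_gt0 // divfK // pnatr_eq0.
exists d => // y Hy; apply: He.
rewrite /dist -[e]gtr0_norm // -sqrtr_sqr ltr_sqrt; last by rewrite exprn_gt0.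
apply: (@le_lt_trans _ _ (\sum_(i < n) d ^+ 2)).
  apply: ler_sum => i _; rewrite -real_normK ?num_real //.
  by rewrite lerXn2r ?nnegrE ?(ltW d0) ?(ltW (Hy i)).
rewrite sumr_const card_ord -mulr_natr ed exprMn ltr_pM2l ?exprn_gt0 //.
rewrite -natrX ltr_nat; nia.
Qed.

Lemma cube_interior_shift x i : cube_interior x ->
  exists2 e : R, 0 < e & forall h, 0 <= h -> h < e -> cube_interior (shift x i h).
Proof.
move=> [e e0 He]; exists (e / 2) => [|h h0 he]; first by lra.
exists (e / 2) => [|y Hy]; first by lra.
apply: He => j; have := Hy j; rewrite /shift !ltr_norml => /andP[].
by case: (j == i); rewrite /= ?mulr1n ?mulr0n => ? ?; apply/andP; split; lra.
Qed.

(** Induction on [k], one derivative per [rho]: with [al = al' + U_(i)], the functional is the limit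
    of difference quotients of [dderiv al'] between [x] and [shift x i h]. *)
Lemma iter_rho_dderiv k x (al : Mon n p) :
  cube_interior x -> (mdeg al <= k)%N ->
  iter k (rho X) (@E0 R n p X) x (dderiv al x).
Proof.
elim: k x al => [|k IHk] x al intx.
  rewrite leqn0 mdeg_eq0 => /eqP ->; split.
    by case: intx => e e0; apply => i; rewrite subrr normr0.
  by exists 1 => m; rewrite mul1r dderiv0.
rewrite leq_eqVlt ltnS => /orP[/eqP dal|leal]; last first.
  by apply: sub_rho; [apply: iter_rho_linear|apply: IHk].
have [i ali] : exists i, (0 < bmnm al i)%N.
  apply/existsP; apply: contra_eqT dal; rewrite negb_exists => /forallP al0.
  rewrite mdegE big1 // => i _; apply/eqP; have := al0 i; by rewrite -eqn0Ngt.
have alE : ((bmnm al - U_(i)) + U_(i))%MM = al.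
  apply/mnmP => j; rewrite mnmDE mnmBE mnm1E; case: eqP => [<-|_]; lia.
have dal' : (mdeg (bmnm al - U_(i))%MM).+1 = mdeg al.
  by rewrite -{2}alE mdegD mdeg1 addn1.
have al'lt : (mdeg (bmnm al - U_(i))%MM < p.+1)%N.
  by have := valP al; rewrite /= -dal'; lia.
pose al' : Mon n p := BMultinom al'lt.
have al'p : (mdeg al' < p)%N by have := valP al; rewrite /= -dal'; lia.
have al'k : (mdeg al' <= k)%N by rewrite -ltnS /= dal' dal.
have p0 : (0 < p)%N by apply: leq_ltn_trans al'p.
have [e e0 He] := cube_interior_shift i intx.
have [C C0 HC] := dderiv_quotient al' x i p0.
have Xx : X x by case: intx => d d0; apply => j; rewrite subrr normr0.
split=> //; apply: in_span_gen; split=> // eps eps0.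
(* The three terms bound powers of [h] by 1, keep the shifted point interior, and make both [h] and
   [C * h] smaller than [eps]. *)
pose h := Num.min (Num.min 1 (e / 2)) (eps / (2 * (C + 1))).
have h0 : 0 < h.
  rewrite !lt_min ltr01 divr_gt0 //= divr_gt0 //; lra.
have h1 : h <= 1 by rewrite /h !ge_min lexx.
have he : h < e.
  by have : h <= e / 2; [rewrite /h !ge_min lexx orbT|lra].
have hC : (2 * (C + 1)) * h <= eps.
  by rewrite mulrC -ler_pdivlMr ?/h ?ge_min ?lexx ?orbT //; lra.
have intb := He h (ltW h0) he; set b := shift x i h in intb.
have linE := iter_rho_linear (R := R) p X k.
have Eb : iter k (rho X) (@E0 R n p X) b (dderiv al' b) by apply: IHk.
have Ex : iter k (rho X) (@E0 R n p X) x (dderiv al' x) by apply: IHk.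
exists x, b, (fun m => - h^-1 * dderiv al' x m + h^-1 * dderiv al' b m).
rewrite dist_refl dist_shift ?(ltW h0) //.
have heps : h < eps by nra.
split; last first.
  do !split=> //; move=> m.
  apply: le_lt_trans (_ : C * h < eps); last by nra.
  have -> : dderiv al x m - (- h^-1 * dderiv al' x m + h^-1 * dderiv al' b m) =
    dderiv (al' + U_(i))%MM x m - h^-1 * (dderiv al' b m - dderiv al' x m).
    by rewrite /= alE; ring.
  exact: HC.
split=> //; split; first exact: (lb_base linE Eb).
exists (fun m => - h^-1 * dderiv al' x m), (fun m => h^-1 * dderiv al' b m).
split; first exact: lb_scale linE Ex. split; first exact: lb_scale linE Eb.
(* The only nonzero component of [eta] is [h^-1], at [al']; since [|al'| < p], the factor
   [h ^+ (p - mdeg al')] absorbs it. *)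
split=> // be; rewrite xi_atZ xi_at_dderiv dist_shift ?(ltW h0) //.
case: eqP => [<-|_]; last by rewrite mulr0 normr0 mulr0.
rewrite mulr1 normfV (gtr0_norm h0).
have -> : (p - mdeg al')%N = (p - mdeg al').-1.+1 by lia.
by rewrite exprSr mulfK ?gt_eqF // exprn_ile1 // ltW.
Qed.

End Tau.

(** For [n > 0] the powers of one variable already give [p.+1] monomials; for [n = 0] the only
    degree is 0. Hence [rdim] iterations leave room for all derivatives. *)
Lemma mdeg_lt_rdim n p (al : Mon n p) : (mdeg al < rdim n p)%N.
Proof.
case: n al => [|n] al.
  by rewrite mdegE big_ord0; apply/card_gt0P; exists al.
have lt (k : 'I_p.+1) : (mdeg (U_(ord0) *+ k : 'X_{1..n.+1})%MM < p.+1)%N.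
  by rewrite mdegMn mdeg1 mul1n.
pose g (k : 'I_p.+1) : Mon n.+1 p := BMultinom (lt k).
have g_inj : injective g.
  move=> j k /(congr1 (mdeg \o val)); rewrite /= !mdegMn mdeg1 !mul1n.
  exact: val_inj.
apply: leq_trans (valP al : mdeg al < p.+1)%N _.
by rewrite -[X in (X <= _)%N](card_ord p.+1); apply: leq_card g_inj.
Qed.

Lemma tau_full (R : realType) n p (X : pt R n -> Prop) a (xi : dual R n p) :
  X a -> (forall e, 0 < e -> exists y, interior X y /\ dist a y < e) -> tau X a xi.
Proof.
move=> Xa cla; rewrite /tau.
have r0 : (0 < rdim n p)%N.
  have z_lt : (mdeg (0%MM : 'X_{1..n}) < p.+1)%N by rewrite mdeg0.
  exact: leq_ltn_trans (mdeg_lt_rdim (BMultinom z_lt)).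
(* The last [rho] is reserved for passing from interior points to their limits. *)
have -> : (2 * rdim n p = (2 * rdim n p).-1.+1)%N by lia.
have linE := iter_rho_linear (R := R) p X (2 * rdim n p).-1.
apply: closure_rho => // eps eps0; have [y [inty lty]] := cla _ eps0.
exists y => //; rewrite (dual_expansion xi y).
have Xy : X y by case: inty => e e0 He; apply: He; rewrite dist_refl.
apply: (lb_sum _ _ linE Xy) => al.
apply: iter_rho_dderiv; first exact: interior_cube.
have := mdeg_lt_rdim al; lia.
Qed.

(** * The Whitney field *)

Section Whitney.
Variables (R : realType) (n p : nat) (X : pt R n -> Prop).
Variables (Phi : bundleR R n p) (T : pt R n -> dual R n p -> R).
Hypothesis linP : linear_bundleR X Phi.
Hypothesis single : forall a l, rhoR X Phi a (fun=> 0) l -> l = 0.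
Hypothesis TP : forall a xi, X a -> Phi a xi (T a xi).

(** The difference of two values over [xi] is a value over 0, excluded by [single] unless it is 0.
    Linearity of [T] on fibres follows. *)
Lemma graph_unique a xi l : Phi a xi l -> T a xi = l.
Proof.
move=> Pl; apply/eqP; rewrite -subr_eq0; apply/eqP; apply: (single (a := a)).
apply: sub_rhoR => //; have := lbR_comb linP (-1) Pl (TP xi (lbR_base linP Pl)).
by rewrite mulN1r addrC; under eq_fun do rewrite mulN1r addNr.
Qed.

Lemma graph_sum a I (s : seq I) (c : I -> R) (w : I -> dual R n p) : X a ->
  T a (fun m => \sum_(i <- s) c i * w i m) = \sum_(i <- s) c i * T a (w i).
Proof.
move=> Xa; apply: graph_unique; elim: s => [|i s IHs].
  by rewrite big_nil; under eq_fun do rewrite big_nil; apply: (lbR_zero linP).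
rewrite big_cons; under eq_fun do rewrite big_cons.
by apply: (lbR_comb linP) => //; apply: TP.
Qed.

(** Apply [T a] to the Taylor expansion of [dderiv al b] at [a]. The Whitney remainder thereby
    compares [T b] and [T a] on one functional. *)
Lemma graph_taylor (al : 'X_{1..n}) a b : X a ->
  \sum_(be : Mon n p | (mdeg be <= p - mdeg al)%N)
    (mfact be)%:R^-1 * T a (dderiv (al + be)%MM a) * mpow (fun i => b i - a i) be
  = T a (dderiv al b).
Proof.
move=> Xa; rewrite (funext (dderiv_taylor al a b)) graph_sum //.
rewrite [RHS](bigID (fun be => mdeg (bmnm be) <= p - mdeg al)%N) /=.
rewrite [X in _ = _ + X]big1 ?addr0 => [|be].
  by apply: eq_bigr => be _; rewrite mulrAC.
rewrite -ltnNge => ltbe.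
have -> : @dderiv R n p (al + be)%MM a = (fun=> 0).
  by apply/funext => m; rewrite dderiv_eq0 // mdegD; lia.
by rewrite (graph_unique (lbR_zero linP Xa)) mulr0.
Qed.

(* A failure of the estimate at [c] can be rescaled to the vertical vector
   [(0, min 1 eps)] in [Phi'_c]. *)
Lemma graph_whitney : whitney_field p X (fun al a => T a (dderiv al a)).
Proof.
move=> c Xc al leal eps eps0; apply: contrapT => fail.
pose d := Num.min 1 eps.
have d0 : 0 < d by rewrite lt_min ltr01.
suff : d = 0 by move=> d00; rewrite d00 ltxx in d0.
apply: (single (a := c)); apply: Phiprime_rhoR; split=> // e e0.
have [a [b [Xa Xb da db lee]]] : exists a b, [/\ X a, X b, dist a c < e, dist b c < e &
    eps <= `|(T b (dderiv al b) - T a (dderiv al b)) / dist b a ^+ (p - mdeg al)|].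
  apply: contrapT => H; apply: fail; exists e => // a b Xa Xb _ da db.
  rewrite graph_taylor // ltNge; apply/negP => lee; apply: H.
  by exists a, b.
set q := dist b a ^+ _ in lee; set w := _ / q in lee.
have w0 : w != 0 by rewrite -normr_gt0; apply: lt_le_trans lee.
have q0 : 0 <= q by rewrite exprn_ge0 // dist_ge0.
(* Scaled so that the value becomes [t * w = d], while [d <= eps <= |w|] keeps [|t| <= 1]. *)
pose t := d / w.
have t1 : `|t| <= 1.
  rewrite normrM normfV (gtr0_norm d0) ler_pdivrMr ?normr_gt0 // mul1r.
  by apply: le_trans lee; rewrite ge_min lexx orbT.
have le_al : (mdeg al < p.+1)%N by [].
exists a, b, (fun=> 0), d; split; last first.
  split; first by rewrite dist_sym.
  split; first by rewrite dist_sym.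
  by split=> [m|]; rewrite subrr normr0.
split=> //; split=> //.
(* Opposite functionals over [a] and [b] cancel, but their values do not. *)
exists (fun m => - (t / q) * dderiv al b m), (- (t / q) * T a (dderiv al b)).
exists (fun m => t / q * dderiv al b m), (t / q * T b (dderiv al b)).
split; first by apply: (lbR_scale _ linP); apply: TP.
split; first by apply: (lbR_scale _ linP); apply: TP.
split=> [m|]; first by ring.
split=> [|be].
  transitivity (t * w); first by rewrite /t divfK.
  by rewrite /w; ring.
rewrite xi_atZ (xi_at_dderiv (BMultinom le_al)).
case: eqP => [<-|_]; last by rewrite mulr0 normr0 mulr0.
rewrite mulr1 /= dist_sym -/q normrM normfV (ger0_norm q0).
have [->|q1] := eqVneq q 0; first by rewrite mul0r.
by rewrite mulrC divfK.
Qed.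

End Whitney.

Theorem theorem4p21 (R : realType) (n : nat) (U X : pt R n -> Prop)
  (f : pt R n -> R) (p : nat) :
  is_open U ->
  (forall x, X x -> U x) ->
  (forall x, X x <-> closure_in U (interior X) x) ->
  (forall (a : pt R n) (xi : dual R n p), tau X a xi ->
     exists! l : R, nabla X f a xi l) ->
  exists F : 'X_{1..n} -> pt R n -> R,
    whitney_field p X F /\ forall a, X a -> F 0%MM a = f a.
Proof.
move=> _ _ Xcl nablaP.
have full a (xi : dual R n p) : X a -> tau X a xi.
  by move=> Xa; apply: tau_full => //; case/Xcl: Xa.
have zero a l : nabla X f a (fun _ : Mon n p => 0) l -> l = 0.
  move=> Nl; have linN := @iter_rhoR_linear R n p X f (2 * (rdim n p).+1).
  have Xa := lbR_base linN Nl.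
  have [l0 [_ uniq]] := nablaP _ _ (full a (fun=> 0) Xa).
  by rewrite -(uniq _ Nl); apply: uniq; apply: lbR_zero linN _ Xa.
(* Stopping at [2 * rdim n p] matches the stage of [tau] and leaves room for another [rhoR] within
   [nabla], so [rhoR X Phi] is still single valued. *)
pose Phi := iter (2 * rdim n p) (rhoR X) (@Phi0 R n p X f).
have [T TP] : exists T : pt R n -> dual R n p -> R,
    forall a xi, X a -> Phi a xi (T a xi).
  have /choice[T HT] : forall ax : pt R n * dual R n p,
      exists l, X ax.1 -> Phi ax.1 ax.2 l.
    move=> [a xi] /=; have [Xa|nXa] := pselect (X a); last by exists 0.
    have le_r : (2 * rdim n p <= 2 * (rdim n p).+1)%N by lia.
    by have [l Pl] := iter_rho_lift zero le_r (full a xi Xa); exists l.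
  by exists (fun a xi => T (a, xi)) => a xi; exact: (HT (a, xi)).
have linP := @iter_rhoR_linear R n p X f (2 * rdim n p).
have single a l : rhoR X Phi a (fun=> 0) l -> l = 0.
  move=> Pl; apply: (zero a); rewrite /nabla.
  by apply: (@iter_rhoR_le _ _ _ _ _ (2 * rdim n p).+1 _ _ _ _ _ Pl); lia.
exists (fun al a => T a (dderiv al a)); split; first exact: (graph_whitney linP single TP).
move=> a Xa; apply: (graph_unique linP single TP).
(* The pair [(delta a, f a)] is already in [Phi0], which fixes the value of [T a] on it. *)
apply: (@iter_rhoR_le _ _ _ _ _ 0) => //.
by split=> //; exists 1; split=> [m|]; rewrite mul1r // dderiv0.
Qed.
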